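(* Let the function $f(t)=r(t)e^{it}:[0,2\pi]\to\gamma$, where $r$ is a positive continuous function with $r(0)=r(2\pi)$, define a Lipschitz Jordan curve $\gamma$ (that is, $f$ is Lipschitz). Then $$\sup_{e^{it}\neq e^{is}}\frac{|f(t)-f(s)|}{|e^{it}-e^{is}|}=\sup_s\limsup_{t\to s}\frac{|f(t)-f(s)|}{|e^{it}-e^{is}|},$$ where $t,s\in[0,2\pi]$.
   Context: $\gamma=f([0,2\pi])$ is a Jordan curve in the complex plane $\mathbf C$, starlike with respect to the origin, and $f$ is its polar parametrization, i.e. $\arg f(t)=t$ (mod $2\pi$). In the limsup, $t\to s$ with $t\neq s$. *)

(* Defs.v *)
From mathcomp Require Import all_boot all_order all_algebra.
From mathcomp Require Import all_classical all_reals all_analysis.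
From mathcomp Require Export complex.
Set Implicit Arguments.
Unset Strict Implicit.
Unset Printing Implicit Defensive.
Import Order.TTheory GRing.Theory Num.Theory.
Import numFieldNormedType.Exports.
Local Open Scope classical_set_scope.
Local Open Scope ring_scope.
Local Open Scope complex_scope.

Definition period (R : realType) : set R := `[0, 2 * pi]%classic.
Arguments period R : clear implicits.

Definition expi (R : realType) (t : R) : R[i] := cos t +i* sin t.

Definition polar (R : realType) (r : R -> R) (t : R) : R[i] :=
  (r t)%:C * expi t.

(* The library's [k.-lipschitz_A f] asks for a normed module over [R] as
   codomain, a structure that [R[i]] does not carry; this is its unfolding with
   the real-valued modulus [normc] (the norm [`|z|] of [R[i]] is valued in
   [R[i]]). *)
Definition lipschitz_within (R : realType) (A : set R) (f : R -> R[i]) : Prop :=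
  exists k : R, forall t s, A t -> A s ->
    Normc.normc (f t - f s) <= k * `|t - s|.

Definition chord_ratio (R : realType) (f : R -> R[i]) (t s : R) : R :=
  Normc.normc (f t - f s) / Normc.normc (expi t - expi s).

(* Main.v *)
Require Import Defs.
From mathcomp Require Import all_boot all_order all_algebra.
From mathcomp Require Import all_classical all_reals all_analysis.
From mathcomp Require Import ring lra.
Set Implicit Arguments.
Unset Strict Implicit.
Import Order.TTheory GRing.Theory Num.Theory.
Import numFieldNormedType.Exports.
Local Open Scope classical_set_scope.
Local Open Scope ring_scope.

(** The right-hand side is at most the left-hand side because parameters near
    [s] and distinct from it give points of the unit circle distinct from that
    of [s], so that their chord ratios count in the supremum over all pairs.

    For the converse, let [K1] exceed all the local upper limits. By the law of
    cosines, [|f t - f s| <= K1 * |e^(it) - e^(is)|] reads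
    [(r t - r s)^2 + r t * r s * u <= K1^2 * u] with
    [u = 2 * (1 - cos (t - s)) <= (t - s)^2]. Holding near each [s], it forces
    [r <= K1] ([radius_le]) and bounds the slope of [r] at [s] by
    [sqrt (K1^2 - r s ^ 2)]. Hence, for every [K > K1], the angle
    [g t = acos (r t / K)] is locally nonexpanding
    ([acos_radius_contraction]), and therefore globally so
    ([local_to_global_contraction]). As [g] takes the same value at [0] and
    [2 * pi], it is nonexpanding also for the arc length on the unit circle.
    The trigonometric inequality [cos_polar_chord_le], applied to the points of
    radii [cos (g t) = r t / K] and [cos (g s) = r s / K], turns this into the
    chord inequality with constant [K] for all pairs ([local_to_global_chord]),
    and [K] is arbitrarily close to the supremum of the local upper limits. *)

(** * Chords in polar coordinates *)

Lemma sqr_normc_expiB (R : realType) (t s : R) :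
  Normc.normc (expi t - expi s) ^+ 2 = 2 * (1 - cos (t - s)).
Proof.
rewrite /expi /= sqr_sqrtr ?addr_ge0 ?sqr_ge0// cosB.
have := cos2Dsin2 t; have := cos2Dsin2 s; lra.
Qed.

(** Law of cosines, written with the
    squared chord [2 * (1 - cos (t - s))] of the unit circle. *)
Lemma sqr_normc_polarB (R : realType) (r : R -> R) (t s : R) :
  Normc.normc (polar r t - polar r s) ^+ 2 =
  (r t - r s) ^+ 2 + r t * r s * (2 * (1 - cos (t - s))).
Proof.
rewrite /polar /expi /= !mul0r !addr0 !subr0.
rewrite sqr_sqrtr ?addr_ge0 ?sqr_ge0// cosB.
have ht : sin t ^+ 2 = 1 - cos t ^+ 2 by rewrite sin2cos2.
have hs : sin s ^+ 2 = 1 - cos s ^+ 2 by rewrite sin2cos2.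
ring: ht hs.
Qed.

Lemma normc_ge0 (R : realType) (z : complex R) : 0 <= Normc.normc z.
Proof. by case: z => x y; exact: sqrtr_ge0. Qed.

Lemma dist_radius_le_normc (R : realType) (r : R -> R) (t s : R) :
  0 <= r t * r s -> `|r t - r s| <= Normc.normc (polar r t - polar r s).
Proof.
move=> rtrs; rewrite -(@ler_pXn2r _ 2)// ?nnegrE ?normc_ge0//.
rewrite real_normK ?num_real// sqr_normc_polarB lerDl mulr_ge0//.
Qed.

(** * Trigonometric inequalities *)

Lemma onem_cosE (R : realType) (x : R) : 1 - cos x = 2 * sin (x / 2) ^+ 2.
Proof.
have E : x = (x / 2) *+ 2 by lra.
rewrite {1}E cos_mulr2n sin2cos2; lra.
Qed.

Lemma cos_lt1 (R : realType) (x : R) : 0 < `|x| < 2 * pi -> cos x < 1.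
Proof.
move=> /andP[x0 x2]; rewrite -subr_gt0 -cos_norm onem_cosE.
by rewrite mulr_gt0// exprn_gt0// sin_gt0_pi//; apply/andP; split; lra.
Qed.

Lemma sqr_sin_le (R : realType) (x : R) : sin x ^+ 2 <= x ^+ 2.
Proof.
wlog x0 : x / 0 <= x.
  move=> h; case: (leP 0 x) => [/h//|xN].
  by rewrite -(sqrrN x) -(sqrrN (sin x)) -sinN h// oppr_ge0 ltW.
have [|y _] := @MVT_segment _ sin cos 0 x x0.
  exact/continuous_subspaceT/continuous_sin.
rewrite sin0 !subr0 => ->; by rewrite exprMn ler_piMl ?sqr_ge0//.
Qed.

Lemma sqr_chord_le (R : realType) (x : R) : 2 * (1 - cos x) <= x ^+ 2.
Proof. rewrite onem_cosE; have := sqr_sin_le (x / 2); lra. Qed.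

Lemma cos_slope_le (R : realType) (a b : R) : 0 <= a -> a <= b -> b <= pi / 2 ->
  (b - a) * sin a <= cos a - cos b.
Proof.
move=> a0 ab bpi.
have [|c] := @MVT_segment _ cos (fun x => - sin x) a b ab.
  exact/continuous_subspaceT/continuous_cos.
rewrite in_itv/= => /andP[ac cb] E.
have -> : cos a - cos b = (b - a) * sin c by lra.
rewrite ler_wpM2l ?subr_ge0//.
by rewrite leNgt ltr_sin -?leNgt// in_itv/=; apply/andP; split; lra.
Qed.

(** * From local to global bounds *)

(** If every point of an interval has a neighbourhood in which [g] does not
    expand the distances to that point, then [g] does not expand the distance
    between the endpoints. *)
Lemma local_to_global_contraction (R : realType) (g : R -> R) (x y : R) :
  x <= y ->
  (forall s, x <= s <= y -> exists2 d, 0 < d &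
     forall t, x <= t <= y -> `|t - s| < d -> `|g t - g s| <= `|t - s|) ->
  `|g y - g x| <= y - x.
Proof.
move=> xy loc.
pose S := [set t | x <= t <= y /\ `|g t - g x| <= t - x].
have Sx : S x by split; [rewrite lexx | rewrite !subrr normr0].
have Sub : has_ubound S by exists y => t [/andP[]].
have xs : x <= sup S by exact: ub_le_sup.
have sy : sup S <= y by apply: ge_sup; [exists x | move=> t [/andP[]]].
have [|d d0 hd] := loc (sup S); first by rewrite xs.
have SsupS : `|g (sup S) - g x| <= sup S - x.
  have [t [txy gt] tS] := sup_adherent d0 (conj (ex_intro _ x Sx) Sub).
  have tle : t <= sup S by apply: ub_le_sup.
  have ts : `|t - sup S| = sup S - t by rewrite distrC ger0_norm// subr_ge0.
  have := hd t txy; rewrite ts => /(_ _) h.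
  have {}h : `|g t - g (sup S)| <= sup S - t by apply: h; lra.
  have := ler_distD (g t) (g (sup S)) (g x); rewrite (distrC _ (g t)); lra.
move: sy; rewrite le_eqVlt => /orP[/eqP <-//|sy].
(* If the supremum were below the endpoint, a point slightly above it would
   still belong to the set. *)
pose t := Num.min y (sup S + d / 2).
have ty : t <= y by rewrite /t ge_min lexx.
have td : t <= sup S + d / 2 by rewrite /t ge_min lexx orbT.
have st : sup S < t by rewrite /t lt_min sy/= ltrDl divr_gt0.
have txy : x <= t <= y by rewrite ty (le_trans xs) ?ltW.
have ts : `|t - sup S| = t - sup S by rewrite ger0_norm// subr_ge0 ltW.
have := hd t txy; rewrite ts => h.
have {}h : `|g t - g (sup S)| <= t - sup S by apply: h; lra.
have St : S t.
  split=> //; have := ler_distD (g (sup S)) (g t) (g x); lra.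
by have := ub_le_sup Sub St; rewrite leNgt st.
Qed.

Lemma acos_div_props (R : realType) (x K : R) : 0 < x -> x < K ->
  [/\ 0 <= acos (x / K), acos (x / K) <= pi / 2,
      x = K * cos (acos (x / K)) &
      K ^+ 2 * sin (acos (x / K)) ^+ 2 = K ^+ 2 - x ^+ 2].
Proof.
move=> x0 xK; have K0 : 0 < K by lra.
have q0 : 0 < x / K by rewrite divr_gt0.
have q1 : x / K < 1 by rewrite ltr_pdivrMr// mul1r.
have q11 : -1 <= x / K <= 1 by apply/andP; split; lra.
have cq : cos (acos (x / K)) = x / K by rewrite acosK.
have Kq : x = K * (x / K) by rewrite mulrC divfK// gt_eqF.
have := acos_ge0 q11; have := acos_lepi q11 => api a0; split => //.
- rewrite leNgt; apply/negP => h.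
  have pi0 := pi_gt0 R.
  have : cos (acos (x / K)) < cos (pi / 2).
    by rewrite ltr_cos// in_itv/=; apply/andP; split; lra.
  by rewrite cos_pihalf cq ltNge (ltW q0).
- by rewrite cq.
- by rewrite sin2cos2 cq [in RHS]Kq; field; rewrite gt_eqF.
Qed.

(** The angle [acos (x / K)] varies at most as fast as the parameter: a chord
    inequality with constant [K1 < K] makes it nonexpanding as soon as the two
    radii are close. The strict inequality [K1 < K] keeps the angle away from
    [0], where [acos] fails to be Lipschitz. *)
Lemma acos_radius_contraction (R : realType) (K1 K x y h : R) :
  K1 < K -> 0 < x -> x <= K1 -> 0 < y -> y <= K1 ->
  (x - y) ^+ 2 <= (K1 ^+ 2 - x * y) * h ^+ 2 ->
  K1 * `|x - y| <= K ^+ 2 - K1 ^+ 2 ->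
  `|acos (x / K) - acos (y / K)| <= `|h|.
Proof.
move=> K1K; wlog yx : x y / y <= x.
  move=> H x0 xK1 y0 yK1 h1 h2; case: (leP y x) => [yx|/ltW xy]; first exact: H.
  rewrite distrC H// 1?(distrC y)//; move: h1; rewrite (mulrC y); nra.
move=> x0 xK1 y0 yK1 h1; rewrite ger0_norm ?subr_ge0// => h2.
have xK : x < K by lra.
have yK : y < K by lra.
have [a0 api ax sa] := acos_div_props x0 xK.
have [b0 bpi by_ sb] := acos_div_props y0 yK.
move: (acos (x / K)) (acos (y / K)) => a b in a0 api ax sa b0 bpi by_ sb *.
have K0 : 0 < K by lra.
have pi0 := pi_gt0 R.
have ab : a <= b.
  rewrite leNgt -ltr_cos ?in_itv/= -?leNgt; last 2 first.
  - by apply/andP; split; lra.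
  - by apply/andP; split; lra.
  by rewrite -(ler_pM2l K0) -ax -by_.
have slope := cos_slope_le a0 ab bpi.
have sa0 : 0 <= sin a by apply: sin_ge0_pi; apply/andP; split; lra.
have {}slope : K * ((b - a) * sin a) <= x - y.
  by rewrite ax by_ -mulrBr ler_pM2l.
have sq : (b - a) ^+ 2 * (K ^+ 2 - x ^+ 2) <= h ^+ 2 * (K ^+ 2 - x ^+ 2).
  rewrite -sa.
  have -> : (b - a) ^+ 2 * (K ^+ 2 * sin a ^+ 2) =
            (K * ((b - a) * sin a)) ^+ 2 by ring.
  apply: (@le_trans _ _ ((x - y) ^+ 2)).
    rewrite ler_pXn2r// nnegrE ?subr_ge0//.
    by rewrite mulr_ge0 ?(ltW K0)// mulr_ge0// subr_ge0.
  apply: (le_trans h1); rewrite mulrC ler_wpM2l ?sqr_ge0// sa.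
  have : x * (x - y) <= K1 * (x - y) by rewrite ler_wpM2r ?subr_ge0.
  nra.
have Kx : 0 < K ^+ 2 - x ^+ 2 by nra.
move: sq; rewrite ler_pM2r// => sq.
rewrite distrC -(@ler_pXn2r _ 2)// ?nnegrE//.
by rewrite !real_normK ?num_real.
Qed.

(** Planar form of the conclusion: points at signed polar radii [cos a] and [cos b]
    whose polar angles differ by [d], with [`|a - b| <= d], are no farther apart
    than the points of the unit circle with the same polar angles. The
    difference of the squared distances is at least
    [(1 - cos (a - b)) ^+ 2]. *)
Lemma cos_polar_chord_le (R : realType) (a b d : R) : `|a - b| <= d -> d <= pi ->
  (cos a - cos b) ^+ 2 + cos a * cos b * (2 * (1 - cos d)) <= 2 * (1 - cos d).
Proof.
move=> abd dpi.
have cd : cos d <= cos (a - b).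
  have d0 := le_trans (normr_ge0 _) abd.
  rewrite -(cos_norm (a - b)) leNgt ltr_cos ?in_itv/= -?leNgt//.
    by rewrite d0.
  by rewrite normr_ge0 (le_trans abd).
have := cos2Dsin2 a; have := cos2Dsin2 b.
have c1 : cos a * cos b <= 1.
  have := sqr_ge0 (cos a - cos b); have := cos2Dsin2 a; have := cos2Dsin2 b.
  have := sqr_ge0 (sin a); have := sqr_ge0 (sin b); nra.
move: cd; rewrite cosB => cd sb sa.
have E : (cos a - cos b) ^+ 2 =
    2 * (1 - cos a * cos b) * (1 - (cos a * cos b + sin a * sin b))
    - (1 - cos a * cos b - sin a * sin b) ^+ 2.
  have sb' : sin b ^+ 2 = 1 - cos b ^+ 2 by rewrite sin2cos2.
  have sa' : sin a ^+ 2 = 1 - cos a ^+ 2 by rewrite sin2cos2.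
  ring: sa' sb'.
have := sqr_ge0 (1 - cos a * cos b - sin a * sin b).
have : 0 <= (1 - cos a * cos b) * (cos a * cos b + sin a * sin b - cos d).
  by rewrite mulr_ge0// subr_ge0.
nra.
Qed.

Lemma periodP (R : realType) (t : R) : period R t <-> 0 <= t <= 2 * pi.
Proof. by rewrite /period/= in_itv. Qed.

Lemma period_punctured_nonempty (R : realType) (s d : R) :
  period R s -> 0 < d -> exists2 t, period R t & 0 < `|t - s| < d.
Proof.
move=> /periodP/andP[s0 s2] d0; have pi0 := pi_gt0 R.
(* A step of at most [pi] towards the farther endpoint stays in the period. *)
pose h := Num.min (d / 2) pi.
have h0 : 0 < h by rewrite lt_min pi0 andbT; lra.
have hd : h <= d / 2 by rewrite ge_min lexx.
have hpi : h <= pi by rewrite ge_min lexx orbT.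
case: (leP s pi) => spi.
  exists (s + h); first by apply/periodP/andP; split; lra.
  by rewrite addrC addKr ger0_norm ?ltW// h0/=; lra.
exists (s - h); first by apply/periodP/andP; split; lra.
by rewrite addrC addKr normrN ger0_norm ?ltW// h0/=; lra.
Qed.

(** Letting [t] tend to [s] in the local chord inequality bounds the radius. *)
Lemma radius_le (R : realType) (r : R -> R) (k K d s : R) : 0 <= K -> 0 < d ->
  period R s ->
  (forall t, period R t -> `|r t - r s| <= k * `|t - s|) ->
  (forall t, period R t -> `|t - s| < d ->
     (r t - r s) ^+ 2 + r t * r s * (2 * (1 - cos (t - s)))
     <= K ^+ 2 * (2 * (1 - cos (t - s)))) ->
  r s <= K.
Proof.
move=> K0 d0 ps lip loc; rewrite leNgt; apply/negP => Kr.
pose k' := Num.max k 1.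
have k'0 : 0 < k' by rewrite lt_max ltr01 orbT.
have kk' : k <= k' by rewrite le_max lexx.
have pi0 := pi_gt0 R.
pose e := Num.min (Num.min d ((r s - K) / k')) (2 * pi).
have e0 : 0 < e by rewrite !lt_min d0 divr_gt0 ?subr_gt0//= mulr_gt0.
have [t pt /andP[ts0 tse]] := period_punctured_nonempty ps e0.
move: tse; rewrite !lt_min => /andP[/andP[tsd tsk] ts2].
have u0 : 0 < 2 * (1 - cos (t - s)) by rewrite mulr_gt0// subr_gt0 cos_lt1// ts0.
have := loc t pt tsd => h.
have rr : r t * r s <= K ^+ 2.
  by rewrite -(ler_pM2r u0) (le_trans _ h)// lerDr sqr_ge0.
have rt : K < r t.
  have := lip t pt => h1.
  have h2 : k' * `|t - s| < r s - K by rewrite mulrC -ltr_pdivlMr.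
  have h3 : k * `|t - s| <= k' * `|t - s| by rewrite ler_wpM2r.
  move: h1; rewrite ler_norml => /andP[]; lra.
nra.
Qed.

(** A chord inequality with constant [K1] that holds near each parameter holds
    between any two parameters, with any larger constant [K]. *)
Lemma local_to_global_chord (R : realType) (r : R -> R) (k K1 K : R) :
  (forall t, period R t -> 0 < r t) -> r 0 = r (2 * pi) ->
  (forall t s, period R t -> period R s -> `|r t - r s| <= k * `|t - s|) ->
  0 <= K1 -> K1 < K ->
  (forall s, period R s -> exists2 d, 0 < d &
     forall t, period R t -> `|t - s| < d ->
     (r t - r s) ^+ 2 + r t * r s * (2 * (1 - cos (t - s)))
     <= K1 ^+ 2 * (2 * (1 - cos (t - s)))) ->
  forall t s, period R t -> period R s ->
     (r t - r s) ^+ 2 + r t * r s * (2 * (1 - cos (t - s)))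
     <= K ^+ 2 * (2 * (1 - cos (t - s))).
Proof.
move=> r0 rper lip K10 K1K loc.
have pi0 := pi_gt0 R.
have rK1 s : period R s -> r s <= K1.
  move=> ps; have [d d0 hd] := loc s ps.
  by apply: (radius_le _ d0 ps _ hd) => // t pt; exact: lip.
pose g t := acos (r t / K).
pose k' := Num.max k 1.
have k'0 : 0 < k' by rewrite lt_max ltr01 orbT.
have kk' : k <= k' by rewrite le_max lexx.
have gloc s : period R s -> exists2 d, 0 < d &
     forall t, period R t -> `|t - s| < d -> `|g t - g s| <= `|t - s|.
  move=> ps; have [d d0 hd] := loc s ps.
  have K1p : 0 < K1 by apply: lt_le_trans (rK1 _ ps); exact: r0.
  have D0 : 0 < K ^+ 2 - K1 ^+ 2 by nra.
  (* The second bound on [t - s] makes the radii close enough for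
     [acos_radius_contraction]. *)
  exists (Num.min d ((K ^+ 2 - K1 ^+ 2) / (K1 * k'))).
    by rewrite lt_min d0 divr_gt0// mulr_gt0.
  move=> t pt; rewrite lt_min => /andP[tsd tsk].
  apply: (@acos_radius_contraction _ K1) => //; try exact: r0; try exact: rK1.
    have := hd t pt tsd.
    have := rK1 t pt; have := rK1 s ps; have := r0 t pt; have := r0 s ps.
    have := sqr_chord_le (t - s) => hc rs0 rt0 rsK rtK hh.
    have rr : 0 <= K1 ^+ 2 - r t * r s by nra.
    have : (K1 ^+ 2 - r t * r s) * (2 * (1 - cos (t - s)))
        <= (K1 ^+ 2 - r t * r s) * (t - s) ^+ 2 by rewrite ler_wpM2l.
    lra.
  have h2 : (K1 * k') * `|t - s| <= K ^+ 2 - K1 ^+ 2.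
    by rewrite mulrC -ler_pdivlMr ?mulr_gt0// ltW.
  apply: le_trans h2; rewrite -mulrA ler_wpM2l//.
  by apply: (le_trans (lip _ _ pt ps)); rewrite ler_wpM2r.
have gcontr x y : 0 <= x -> x <= y -> y <= 2 * pi -> `|g y - g x| <= y - x.
  move=> x0 xy y2; apply: local_to_global_contraction => // s /andP[xs sy].
  have [|d d0 hd] := gloc s; first by apply/periodP/andP; split; lra.
  exists d => // t /andP[xt ty]; apply: hd; apply/periodP/andP; split; lra.
move=> t s; wlog st : t s / s <= t.
  move=> H pt ps; case: (leP s t) => [st|/ltW ts]; first exact: H.
  have := H s t ts ps pt.
  by rewrite -(cosN (s - t)) opprB (mulrC (r s)) -(sqrrN (r s - r t)) opprB.
move=> pt ps.
have rtK : r t < K by apply: le_lt_trans (rK1 _ pt) K1K.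
have rsK : r s < K by apply: le_lt_trans (rK1 _ ps) K1K.
have [_ _ ta _] := acos_div_props (r0 _ pt) rtK.
have [_ _ sa _] := acos_div_props (r0 _ ps) rsK.
rewrite -/(g t) in ta; rewrite -/(g s) in sa.
have /periodP/andP[t0 t2] := pt; have /periodP/andP[s0 s2] := ps.
suff : (cos (g t) - cos (g s)) ^+ 2
    + cos (g t) * cos (g s) * (2 * (1 - cos (t - s))) <= 2 * (1 - cos (t - s)).
  move=> /(ler_wpM2l (sqr_ge0 K)) h; apply: le_trans h.
  rewrite {1 2}ta {1 2}sa le_eqVlt; apply/orP; left; apply/eqP; ring.
case: (leP (t - s) pi) => tspi.
  by apply: cos_polar_chord_le => //; apply: gcontr.
(* The arc from [t] to [s] through the closing point is the shorter one. *)
have -> : cos (t - s) = cos (2 * pi - (t - s)).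
  by rewrite -(cosN (t - s)) -(cosD2pi (- (t - s))); congr cos; lra.
apply: cos_polar_chord_le; last lra.
have g02 : g 0 = g (2 * pi) by rewrite /g rper.
have h1 := gcontr t (2 * pi) t0 t2 (lexx _).
have h2 := gcontr 0 s (lexx _) s0 s2; rewrite g02 in h2.
have := ler_distD (g (2 * pi)) (g t) (g s).
rewrite (distrC (g t) (g (2 * pi))) (distrC (g (2 * pi)) (g s)); lra.
Qed.

(** * Chord ratios and their upper limits *)

Lemma chord_ratio_ge0 (R : realType) (f : R -> complex R) (t s : R) :
  0 <= chord_ratio f t s.
Proof. by rewrite divr_ge0// normc_ge0. Qed.

Lemma normc_expiB_gt0 (R : realType) (t s : R) :
  expi t != expi s -> 0 < Normc.normc (expi t - expi s).
Proof.
move=> ne; rewrite lt_neqAle normc_ge0 andbT eq_sym; apply/eqP => /Normc.eq0_normc.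
by move/eqP; rewrite subr_eq0 (negbTE ne).
Qed.

Lemma chord_ratio_le (R : realType) (r : R -> R) (K t s : R) :
  0 <= K -> expi t != expi s ->
  (chord_ratio (polar r) t s <= K) =
  ((r t - r s) ^+ 2 + r t * r s * (2 * (1 - cos (t - s)))
     <= K ^+ 2 * (2 * (1 - cos (t - s)))).
Proof.
move=> K0 /normc_expiB_gt0 e0.
rewrite /chord_ratio ler_pdivrMr// -sqr_normc_polarB -sqr_normc_expiB -exprMn.
by rewrite ler_pXn2r// nnegrE ?normc_ge0// mulr_ge0// normc_ge0.
Qed.

Lemma expi_neq (R : realType) (t s : R) :
  0 < `|t - s| < 2 * pi -> expi t != expi s.
Proof.
move=> /cos_lt1 c1; apply/eqP => E; have := sqr_normc_expiB t s.
by rewrite E subrr Normc.normc0 expr0n/= => /eqP; rewrite lt_eqF// mulr_gt0// subr_gt0.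
Qed.

(** A strict upper bound of the limit superior bounds the ratio near [s]. *)
Lemma limf_esup_lt_near (R : realType) (f : R -> complex R) (s K : R) :
  (limf_esup (fun t => (chord_ratio f t s)%:E) (within (period R) s^') < K%:E)%E ->
  exists2 d, 0 < d &
    forall t, period R t -> 0 < `|t - s| < d -> chord_ratio f t s <= K.
Proof.
move=> /ereal_inf_lt[_ [V nV <-] VK].
move: nV => /nbhs_ballP[d /= d0 hd]; exists d => // t pt /andP[ts0 tsd].
rewrite -lee_fin; apply: le_trans (ltW VK); apply: ereal_sup_ubound.
exists t => //; apply: hd => //; first by rewrite /ball/= distrC.
by rewrite -subr_eq0 -normr_gt0.
Qed.

Theorem theorem3p1 (R : realType) (r : R -> R)
    (r_gt0 : forall t, period R t -> 0 < r t)
    (r_cont : {within period R, continuous r})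
    (r_closed : r 0 = r (2 * pi))
    (f_lip : lipschitz_within (period R) (polar r)) :
  ereal_sup [set (chord_ratio (polar r) p.1 p.2)%:E | p in
    [set p : R * R |
      [/\ period R p.1, period R p.2 & expi p.1 != expi p.2]]] =
  ereal_sup [set limf_esup (fun t => (chord_ratio (polar r) t s)%:E)
                           (within (period R) s^') | s in period R].
Proof.
have pi0 := pi_gt0 R.
apply/eqP; rewrite eq_le; apply/andP; split; last first.
  apply: ge_ereal_sup => _ [s ps <-].
  pose V := [set t | period R t /\ expi t != expi s].
  apply: (@le_trans _ _
    (ereal_sup [set (chord_ratio (polar r) t s)%:E | t in V])).
    apply: ereal_inf_lbound; exists V => //.
    apply/nbhs_ballP; exists (2 * pi) => /=; first by rewrite mulr_gt0.
    move=> t; rewrite /ball/= distrC => ts2 tns pt; split => //.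
    by apply: expi_neq; rewrite ts2 andbT normr_gt0 subr_eq0.
  apply: ge_ereal_sup => _ [t [pt ets] <-].
  by apply: ereal_sup_ubound; exists (t, s).
apply: ge_ereal_sup => _ [[t s]/= [pt ps ets] <-].
rewrite leNgt; apply/negP; set M := ereal_sup _; set c := chord_ratio _ _ _ => Mc.
have [K1 MK1 K1c] : exists2 K1, (M < K1%:E)%E & K1 < c.
  case: M Mc => [m||]; rewrite ?lte_fin// => mc.
    by exists ((m + c) / 2); rewrite ?lte_fin; lra.
  by exists (c - 1); rewrite ?ltNyr//; lra.
have loc u : period R u -> exists2 d, 0 < d &
    forall v, period R v -> 0 < `|v - u| < d -> chord_ratio (polar r) v u <= K1.
  move=> pu; apply: limf_esup_lt_near; apply: le_lt_trans MK1.
  by apply: ereal_sup_ubound; exists u.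
have K10 : 0 <= K1.
  have [d d0 hd] := loc t pt.
  have [v pv hv] := period_punctured_nonempty pt d0.
  exact: le_trans (chord_ratio_ge0 _ _ _) (hd v pv hv).
have [k hk] := f_lip.
(* The constant [(K1 + c) / 2] lies strictly between [K1] and the ratio [c],
   which is assumed to exceed the supremum [M] of the upper limits. *)
have cK : c <= (K1 + c) / 2.
  rewrite chord_ratio_le//; last by lra.
  apply: (@local_to_global_chord _ _ k K1) => //; last 2 first.
  - lra.
  - move=> u pu; have [d d0 hd] := loc u pu.
    (* Within distance [2 * pi], distinct parameters have distinct images on the
       unit circle. *)
    exists (Num.min d (2 * pi)); first by rewrite lt_min d0 mulr_gt0.
    move=> v pv; rewrite lt_min => /andP[vud vu2].
    case: (eqVneq v u) => [->|vu].
      by rewrite !subrr cos0 subrr !mulr0 expr0n/= addr0.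
    have vu0 : 0 < `|v - u| by rewrite normr_gt0 subr_eq0.
    by rewrite -chord_ratio_le ?hd ?vu0//; apply: expi_neq; rewrite vu0.
  - move=> u v pu pv; apply: le_trans (hk u v pu pv).
    by apply: dist_radius_le_normc; rewrite mulr_ge0// ltW// r_gt0.
by lra.
Qed.
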